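(* Let $a,b,a',b'>0$, and let $X\sim\mathrm{Beta}(a,b)$ and $Y\sim\mathrm{Beta}(a',b')$. Then $X\le_\ast Y$ if and only if $a\ge a'$ and $b\le b'$.
   Context: For $a,b>0$, $\mathrm{Beta}(a,b)$ is the distribution on $[0,1]$ with density $x^{a-1}(1-x)^{b-1}/\mathrm{B}(a,b)$ for $x\in(0,1)$, where $\mathrm{B}(a,b)=\int_0^1 y^{a-1}(1-y)^{b-1}\,dy$. Its distribution function is a strictly increasing continuous bijection $[0,1]\to[0,1]$. A function $f\colon[0,r]\to\mathbb{R}$ is star-shaped if $f(\alpha x)\le\alpha f(x)$ for every $x$ in its domain and every $0\le\alpha\le1$. Star-shaped order $\le_\ast$: if $X$ and $Y$ have distributions supported by intervals $I=[0,r]$ and $J=[0,s]$ ($r,s>0$) with strictly increasing distribution functions $F\colon I\to[0,1]$ and $G\colon J\to[0,1]$, then $X\le_\ast Y$ means that the mapping $x\mapsto G^{-1}(F(x))$ is star-shaped on $I$. For Beta distributions $I=J=[0,1]$. *)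

(* Defs.v *)
From HB Require Import structures.
From mathcomp Require Export all_boot all_order all_algebra.
From mathcomp Require Export all_classical all_reals all_analysis.

Set Implicit Arguments.
Unset Strict Implicit.
Unset Printing Implicit Defensive.

Import Order.TTheory GRing.Theory Num.Theory.
Import numFieldNormedType.Exports.

Local Open Scope classical_set_scope.
Local Open Scope ring_scope.

(* The library's [beta_fun] and [beta_pdf] take natural parameters; these are
   their analogues for real a, b > 0. Since 0 `^ p = 0 for p <> 0, the integrand
   takes conventional values at 0 and 1, which do not affect the integral. *)
Definition rbeta_kernel (R : realType) (a b x : R) : R :=
  x `^ (a - 1) * (1 - x) `^ (b - 1).

Definition rbeta_fun (R : realType) (a b : R) : R :=
  \int[lebesgue_measure]_(x in `[0, 1]) rbeta_kernel a b x.

Definition rbeta_pdf (R : realType) (a b x : R) : R :=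
  if x \in `]0, 1[ then rbeta_kernel a b x / rbeta_fun a b else 0.

Definition beta_distributed (R : realType) (d : measure_display)
    (T : measurableType d) (P : probability T R) (a b : R)
    (X : {RV P >-> R}) : Prop :=
  forall A : set R, measurable A ->
    distribution P X A =
    (\int[lebesgue_measure]_(x in A) (rbeta_pdf a b x)%:E)%E.

Definition star_shaped (R : realType) (r : R) (f : R -> R) : Prop :=
  forall x alpha : R, 0 <= x <= r -> 0 <= alpha <= 1 ->
    f (alpha * x) <= alpha * f x.

(* The class of laws compared by the star-shaped order. Such an r is unique. *)
Definition star_interval (R : realType) (d : measure_display)
    (T : measurableType d) (P : probability T R) (X : {RV P >-> R})
    (r : R) : Prop :=
  [/\ 0 < r, distribution P X `[0, r] = 1%E &
      forall x y : R, 0 <= x -> x < y -> y <= r -> (cdf X x < cdf X y)%E].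

(* The inverse of G : [0, s] -> [0, 1] is the partial inverse of [cdf Y] on
   [0, s]; its default value 0 is used only off the range of G. *)
Definition star_le (R : realType) (d d' : measure_display)
    (T : measurableType d) (T' : measurableType d')
    (P : probability T R) (Q : probability T' R)
    (X : {RV P >-> R}) (Y : {RV Q >-> R}) : Prop :=
  exists r s : R, [/\ star_interval X r, star_interval Y s &
    star_shaped r (fun x => 'pinv_(fun=> 0) `[0, s] (cdf Y) (cdf X x))].

(* Main.v *)
Require Import Defs.
From mathcomp Require Import all_boot all_order all_algebra.
From mathcomp Require Import all_classical all_reals all_analysis.
From mathcomp Require Import measurable_realfun lra ring.

(* Let F, G be the two distribution functions, f, g their densities and
   phi = G^-1 o F.

   If phi is star-shaped then phi x <= x, as phi 1 = 1; hence F <= G, and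
   comparing f with g near 0 and, after reflection, near 1 gives a' <= a and
   b <= b'.

   Conversely fix x, let c = phi x / x and h t = G (c t) - F t; star-shapedness
   says h >= 0 on [0, x]. Here h 0 = h x = 0 and, as c <= 1, h 1 <= 0. The sign
   of h' is that of L t = ln (c g(c t) / f t), and L' has at most one sign
   change on ]0, 1[, from negative to positive (and none if c = 1). If h took a
   negative value before x, the mean value theorem would yield u1 < u2 < u3
   with L u1 < 0 < L u2 and L u3 <= 0, so L' would be positive and then
   negative. The bound c <= 1, i.e. F <= G, is the same argument with c = 1. *)

Set Implicit Arguments.
Unset Strict Implicit.

Import Order.TTheory GRing.Theory Num.Theory.
Import numFieldNormedType.Exports.

Local Open Scope classical_set_scope.
Local Open Scope ring_scope.

(** * Distribution functions with a Beta density *)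

(** [k] stands for the normalising constant 1/B(a,b), left abstract: the comparison then involves no
    probability, and the reflection x -> 1 - x swaps [a] and [b] with the same [k]. *)
Record beta_cdf_like (R : realType) (a b k : R) (F : R -> R) : Prop := {
  bcl_cont : continuous F;
  bcl0 : F 0 = 0;
  bcl1 : F 1 = 1;
  bcl_gt0 : 0 < k;
  bcl_deriv : forall x : R, 0 < x < 1 ->
    is_derive x (1 : R) F (k * rbeta_kernel a b x) }.

Definition log_kernel (R : realType) (a b k x : R) : R :=
  ln k + (a - 1) * ln x + (b - 1) * ln (1 - x).

Lemma rbeta_kernelE (R : realType) (a b k x : R) : 0 < k -> 0 < x < 1 ->
  k * rbeta_kernel a b x = expR (log_kernel a b k x).
Proof.
move=> k0 /andP[x0 x1]; rewrite /rbeta_kernel /log_kernel /powR.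
by rewrite !gt_eqF ?subr_gt0// !expRD lnK ?posrE// mulrA.
Qed.

Lemma is_derive_log_kernel (R : realType) (a b k x : R) : 0 < x < 1 ->
  is_derive x (1 : R) (log_kernel a b k) ((a - 1) / x - (b - 1) / (1 - x)).
Proof.
move=> /andP[x0 x1].
have x1' : 0 < 1 - x by rewrite subr_gt0.
have d0 := is_derive1_ln x0.
have d1 : is_derive x (1 : R) (@ln R \o (fun t : R => 1 - t)) ((1 - x)^-1 * (0 - 1)).
  by apply: is_derive1_comp; exact: is_derive1_ln.
have := is_deriveD (is_deriveD (is_derive_cst (ln k) x (1 : R))
  (is_deriveZ (a - 1) d0)) (is_deriveZ (b - 1) d1).
by rewrite add0r sub0r mulrN1 scalerN.
Qed.

(** The derivative is asked for only strictly inside the interval, since a Beta density may blow up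
    at 0 or 1. *)
Lemma MVT_increase (R : realType) (h dh : R -> R) (x y : R) : x < y ->
  (forall z, x < z < y -> is_derive z (1 : R) h (dh z)) ->
  (forall z, x <= z <= y -> {for z, continuous h}) ->
  exists2 z, x < z < y & h y - h x = dh z * (y - x).
Proof.
move=> xy hd hc.
have hd' z : z \in `]x, y[ -> is_derive z (1 : R) h (dh z).
  by rewrite in_itv; exact: hd.
have hc' : {within `[x, y], continuous h}.
  by apply: continuous_in_subspaceT => z; rewrite inE/= in_itv/= => ?; exact: hc.
have [z zxy e] := MVT xy hd' hc'.
by exists z => //; move: zxy; rewrite in_itv.
Qed.

Section MVT_sign.
Context (R : realType) (h dh : R -> R) (x y : R).
Hypotheses (xy : x < y)
  (hd : forall z, x < z < y -> is_derive z (1 : R) h (dh z))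
  (hc : forall z, x <= z <= y -> {for z, continuous h}).

Lemma MVT_pos : h x < h y -> exists2 z, x < z < y & 0 < dh z.
Proof.
move=> hxy; have [z zxy e] := MVT_increase xy hd hc.
by exists z => //; move: hxy; rewrite -subr_gt0 e pmulr_lgt0// subr_gt0.
Qed.

Lemma MVT_neg : h y < h x -> exists2 z, x < z < y & dh z < 0.
Proof.
move=> hxy; have [z zxy e] := MVT_increase xy hd hc.
by exists z => //; move: hxy; rewrite -subr_lt0 e pmulr_llt0// subr_gt0.
Qed.

Lemma MVT_npos : h y <= h x -> exists2 z, x < z < y & dh z <= 0.
Proof.
move=> hxy; have [z zxy e] := MVT_increase xy hd hc.
by exists z => //; move: hxy; rewrite -subr_le0 e pmulr_lle0// subr_gt0.
Qed.

End MVT_sign.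

Lemma bcl_lt (R : realType) (a b k : R) (F : R -> R) :
  beta_cdf_like a b k F -> {in `[0, 1] &, {homo F : x y / x < y}}.
Proof.
move=> [cF _ _ k0 dF] x y; rewrite !in_itv/= => /andP[x0 _] /andP[_ y1] xy.
have in01 z : x < z < y -> 0 < z < 1.
  by move=> /andP[xz zy]; rewrite (le_lt_trans x0 xz) (lt_le_trans zy).
have [z zxy e] := MVT_increase xy (fun z zxy => dF z (in01 z zxy)) (fun z _ => cF z).
rewrite -subr_gt0 e rbeta_kernelE ?in01// mulr_gt0 ?expR_gt0 ?subr_gt0//.
Qed.

(** * Sign pattern of the logarithmic derivative of the density ratio *)

Section ratio.
Context (R : realType).

(* (1 - x) times the logarithmic derivative of c g(c x) / f(x). *)
Definition log_ratio_slope (a b a' b' c x : R) : R := (b - 1) - (1 - x) / x * (a - a')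
  - (b' - 1) * (c * ((1 - x) / (1 - c * x))).

Lemma log_ratio_deriv (a b a' b' c x : R) : 0 < x < 1 -> 0 < c <= 1 ->
  (((a' - 1) / (c * x) - (b' - 1) / (1 - c * x)) * c
   - ((a - 1) / x - (b - 1) / (1 - x))) * (1 - x) = log_ratio_slope a b a' b' c x.
Proof.
move=> /andP[x0 x1] /andP[c0 c1]; rewrite /log_ratio_slope; field.
have cx : c * x < 1 by rewrite (le_lt_trans _ x1)// ler_piMl// ltW.
by rewrite (gt_eqF x0) (gt_eqF c0) !gt_eqF// subr_gt0.
Qed.

(** The subtracted term with a - a' is nonnegative. If c = 1 the rest is b - b'. Otherwise r =
    c(1-x)/(1-cx) lies in [0,1] and, as b <= b', the rest is at most (b-1)(1-r) <= 0. *)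
Lemma log_ratio_slope_le0 (a b a' b' c x : R) : 0 < x < 1 -> 0 < c <= 1 -> a' <= a ->
  b <= b' -> c = 1 \/ b <= 1 -> log_ratio_slope a b a' b' c x <= 0.
Proof.
move=> /andP[x0 x1] /andP[c0 c1] aa bb.
have cx : c * x < 1 by rewrite (le_lt_trans _ x1)// ler_piMl// ltW.
have A0 : 0 <= (1 - x) / x * (a - a').
  by rewrite mulr_ge0 ?divr_ge0 ?subr_ge0// ltW.
have r0 : 0 <= c * ((1 - x) / (1 - c * x)).
  by rewrite mulr_ge0 ?divr_ge0 ?subr_ge0// ltW.
rewrite /log_ratio_slope; move=> [c_1|b1].
  by subst c; rewrite mul1r mul1r divff ?gt_eqF ?subr_gt0//; lra.
have r1 : c * ((1 - x) / (1 - c * x)) <= 1.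
  by rewrite mulrA ler_pdivrMr ?subr_gt0//; nra.
set r := c * _ in r0 r1 *; nra.
Qed.

(** Both (1-x)/x and (1-x)/(1-cx) are nonincreasing in x, and their coefficients -(a-a') and
    -c(b'-1) are nonpositive. *)
Lemma log_ratio_slope_nondecreasing (a b a' b' c x y : R) : 0 < x -> x < y -> y < 1 ->
  0 < c <= 1 -> a' <= a -> 1 <= b' ->
  log_ratio_slope a b a' b' c x <= log_ratio_slope a b a' b' c y.
Proof.
move=> x0 xy y1 /andP[c0 c1] aa bb.
have cy : c * y < 1 by rewrite (le_lt_trans _ y1)// ler_piMl// ltW// (lt_trans x0).
have cx : c * x < 1 by rewrite (le_lt_trans _ cy)// ler_pM2l// ltW.
have y0 := lt_trans x0 xy.
have h1 : (1 - y) / y <= (1 - x) / x.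
  by rewrite ler_pdivrMr// mulrAC ler_pdivlMr//; nra.
have h2 : (1 - y) / (1 - c * y) <= (1 - x) / (1 - c * x).
  by rewrite ler_pdivrMr ?subr_gt0// mulrAC ler_pdivlMr ?subr_gt0//; nra.
have h3 : c * ((1 - y) / (1 - c * y)) <= c * ((1 - x) / (1 - c * x)).
  by rewrite ler_pM2l.
rewrite /log_ratio_slope; set p := (1 - y) / y in h1 *; set q := (1 - x) / x in h1 *.
set r := c * _ in h3 *; set s := c * _ in h3 *; nra.
Qed.

(** If b' > 1 the slope is nondecreasing; if b' <= 1 then also b <= 1, and the slope is never
    positive. *)
Lemma log_ratio_single_crossing (a b a' b' c x y : R) :
  0 < x -> x < y -> y < 1 -> 0 < c < 1 -> a' <= a -> b <= b' ->
  0 < log_ratio_slope a b a' b' c x -> 0 < log_ratio_slope a b a' b' c y.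
Proof.
move=> x0 xy y1 /andP[c0 c1] aa bb.
have c01 : 0 < c <= 1 by rewrite c0 ltW.
have [b1|b1] := leP b' 1.
  by rewrite ltNge log_ratio_slope_le0// ?x0 ?(lt_trans xy y1)//; right; lra.
move=> /lt_le_trans; apply; apply: log_ratio_slope_nondecreasing => //; exact: ltW.
Qed.
End ratio.

(** * Comparison of two Beta distribution functions *)

Section star_comparison.
Context (R : realType) (a b a' b' k k' : R) (F G : R -> R).
Hypotheses (HF : beta_cdf_like a b k F) (HG : beta_cdf_like a' b' k' G).

Implicit Types c x y t u v z : R.

(** [gap c] is the function h of the introductory comment, [dgap c] is h' and [log_ratio c] is L. *)
Let gap (c t : R) := G (c * t) - F t.
Let dgap (c t : R) :=
  k' * rbeta_kernel a' b' (c * t) * c - k * rbeta_kernel a b t.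
Let log_ratio (c t : R) :=
  ln c + log_kernel a' b' k' (c * t) - log_kernel a b k t.

Lemma scale_in01 (c x : R) : 0 < c <= 1 -> 0 < x < 1 -> 0 < c * x < 1.
Proof.
move=> /andP[c0 c1] /andP[x0 x1]; rewrite mulr_gt0//=.
by rewrite (le_lt_trans _ x1)// ler_piMl// ltW.
Qed.

Let is_derive_gap c x : 0 < c <= 1 -> 0 < x < 1 ->
  is_derive x (1 : R) (gap c) (dgap c x).
Proof.
move=> c01 x01; have cx01 := scale_in01 c01 x01.
have dF := bcl_deriv HF x01; have dG := bcl_deriv HG cx01.
have dl : is_derive x (1 : R) (fun t : R => c * t) c.
  by have := is_deriveZ c (is_derive_id x (1 : R)); rewrite /GRing.scale/= mulr1.
have dGc : is_derive x (1 : R) (G \o (fun t : R => c * t))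
  (k' * rbeta_kernel a' b' (c * x) * c) by exact: is_derive1_comp.
exact (is_deriveB dGc dF).
Qed.

Let cont_gap c : continuous (gap c).
Proof.
move=> x; apply: cvgB; last exact: (bcl_cont HF).
by apply: continuous_comp; [exact: mulrl_continuous|exact: (bcl_cont HG)].
Qed.

Let is_derive_log_ratio c x : 0 < c <= 1 -> 0 < x < 1 ->
  is_derive x (1 : R) (log_ratio c)
    (log_ratio_slope a b a' b' c x / (1 - x)).
Proof.
move=> c01 x01; have cx01 := scale_in01 c01 x01.
have x1 : 1 - x != 0 by case/andP: x01 => _ x1; rewrite gt_eqF// subr_gt0.
rewrite -(log_ratio_deriv a b a' b' x01 c01) mulfK//.
have dF := is_derive_log_kernel a b k x01.
have dG := is_derive_log_kernel a' b' k' cx01.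
have dl : is_derive x (1 : R) (fun t : R => c * t) c.
  by have := is_deriveZ c (is_derive_id x (1 : R)); rewrite /GRing.scale/= mulr1.
have dGc := is_derive1_comp dG dl.
have := is_deriveB (is_deriveD (is_derive_cst (ln c) x (1 : R)) dGc) dF.
by rewrite add0r.
Qed.

(** A difference of two exponentials whose exponents differ by [log_ratio c x]; hence [dgap] and
    [log_ratio] have the same sign. *)
Let dgapE c x : 0 < c <= 1 -> 0 < x < 1 ->
  dgap c x = expR (ln c + log_kernel a' b' k' (c * x)) - expR (log_kernel a b k x).
Proof.
move=> c01 x01; have cx01 := scale_in01 c01 x01; rewrite /dgap.
rewrite !rbeta_kernelE//; [|exact: bcl_gt0 HF|exact: bcl_gt0 HG].
by rewrite expRD lnK 1?mulrC//; case/andP: c01.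
Qed.

Let dgap_gt0 c x : 0 < c <= 1 -> 0 < x < 1 ->
  (0 < dgap c x) = (0 < log_ratio c x).
Proof. by move=> *; rewrite dgapE// subr_gt0 ltr_expR subr_gt0. Qed.

Let dgap_lt0 c x : 0 < c <= 1 -> 0 < x < 1 ->
  (dgap c x < 0) = (log_ratio c x < 0).
Proof. by move=> *; rewrite dgapE// subr_lt0 ltr_expR subr_lt0. Qed.

Let dgap_le0 c x : 0 < c <= 1 -> 0 < x < 1 ->
  (dgap c x <= 0) = (log_ratio c x <= 0).
Proof. by move=> *; rewrite dgapE// subr_le0 ler_expR subr_le0. Qed.

(** [log_ratio_slope] is the derivative of [log_ratio c] times the positive factor 1 - z, so the
    mean value theorem controls its sign. *)
Let log_ratio_change c u v : 0 < c <= 1 -> 0 < u -> u < v -> v < 1 ->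
  (log_ratio c u < log_ratio c v ->
    exists2 z, u < z < v & 0 < log_ratio_slope a b a' b' c z) /\
  (log_ratio c v < log_ratio c u ->
    exists2 z, u < z < v & log_ratio_slope a b a' b' c z < 0).
Proof.
move=> c01 u0 uv v1.
have in01 z : u <= z <= v -> 0 < z < 1.
  by move=> /andP[? ?]; rewrite (lt_le_trans u0) ?(le_lt_trans _ v1).
have in01' z : u < z < v -> 0 < z < 1.
  by move=> /andP[? ?]; apply: in01; rewrite !ltW.
have cl z : u <= z <= v -> {for z, continuous (log_ratio c)}.
  move=> /in01 /(is_derive_log_ratio c01)[dl _].
  exact/differentiable_continuous/derivable1_diffP.
have dl z (zuv : u < z < v) := is_derive_log_ratio c01 (in01' z zuv).
have z1 z : u < z < v -> 0 < (1 - z)^-1.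
  by move=> /in01' /andP[_ ?]; rewrite invr_gt0 subr_gt0.
split=> [/(MVT_pos uv dl cl)|/(MVT_neg uv dl cl)] [z zuv pz]; exists z => //.
- by move: pz; rewrite pmulr_lgt0// z1.
- by move: pz; rewrite pmulr_llt0// z1.
Qed.

Let gap_change c x y : 0 < c <= 1 -> 0 <= x -> x < y -> y <= 1 ->
  [/\ gap c x < gap c y -> exists2 z, x < z < y & 0 < log_ratio c z,
      gap c y < gap c x -> exists2 z, x < z < y & log_ratio c z < 0 &
      gap c y <= gap c x -> exists2 z, x < z < y & log_ratio c z <= 0].
Proof.
move=> c01 x0 xy y1.
have in01 z : x < z < y -> 0 < z < 1.
  by move=> /andP[? ?]; rewrite (le_lt_trans x0) ?(lt_le_trans _ y1).
have dg z (zxy : x < z < y) := is_derive_gap c01 (in01 z zxy).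
have cg z (_ : x <= z <= y) := @cont_gap c z.
split=> [/(MVT_pos xy dg cg)|/(MVT_neg xy dg cg)|/(MVT_npos xy dg cg)].
- by move=> [z zxy zp]; exists z => //; rewrite -dgap_gt0// in01.
- by move=> [z zxy zp]; exists z => //; rewrite -dgap_lt0// in01.
- by move=> [z zxy zp]; exists z => //; rewrite -dgap_le0// in01.
Qed.

Let gap0 c : gap c 0 = 0.
Proof. by rewrite /gap mulr0 (bcl0 HF) (bcl0 HG) subrr. Qed.

(** If a' < a, the term (a' - a) ln z dominates near 0 and makes [log_ratio 1] positive there, so
    [gap 1] would increase from 0, against G <= F. *)
Lemma beta_cdf_ge_exponent :
  (forall x, 0 <= x <= 1 -> G x <= F x) -> a <= a'.
Proof.
move=> GF; rewrite leNgt; apply/negP => aa'.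
(* For z < [d], 1 - z >= 1/2 bounds (b' - b) ln(1 - z) below by |b' - b| ln(1/2), and the second
   bound in [d] gives (a' - a) ln z > [C]; together they make [log_ratio 1 z] positive. *)
pose C := ln k - ln k' - `|b' - b| * ln (2^-1 : R).
pose d := Num.min 2^-1 (expR (- (C / (a - a')))).
have d0 : 0 < d by rewrite lt_min expR_gt0 invr_gt0 ltr0n.
have d2 : d <= 2^-1 by rewrite ge_min lexx.
have d1 : d <= 1 by lra.
have c01 : 0 < (1 : R) <= 1 by rewrite ltr01 lexx.
have [_ _ +] := gap_change c01 (lexx 0) d0 d1.
have -> : gap 1 d <= gap 1 0.
  by rewrite gap0 /gap mul1r subr_le0 GF// d1 ltW.
move=> /(_ isT)[z /andP[z0 zd]]; apply/negP; rewrite -ltNge.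
rewrite /log_ratio ln1 add0r mul1r /log_kernel.
have lz : (a - a') * ln z < - C.
  rewrite mulrC -ltr_pdivlMr ?subr_gt0// mulNr -[ltRHS]expRK.
  by rewrite ltr_ln ?posrE ?expR_gt0// (lt_le_trans zd)// ge_min lexx orbT.
have l1 : ln (1 - z) <= 0 by apply: ln_le0; lra.
have l2 : ln (2^-1 : R) <= ln (1 - z) by rewrite ler_ln ?posrE; lra.
have : `|b' - b| * ln (2^-1 : R) <= (b' - b) * ln (1 - z).
  rewrite (le_trans (ler_wpM2l (normr_ge0 _) l2))//.
  by rewrite ler_wnM2r// ler_norm.
by rewrite /C in lz; lra.
Qed.

Hypotheses (aa : a' <= a) (bb : b <= b').

(** [gap c] falls from 0 to a negative value and returns to 0: [log_ratio c] is negative somewhere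
    before x1 and positive at some v after it, so its slope is positive in between. *)
Let gap_lt0 c x x1 : 0 < c <= 1 -> 0 < x1 -> x1 < x -> x <= 1 ->
  gap c x = 0 -> gap c x1 < 0 ->
  exists u v, [/\ u < v, v < x, 0 < u, 0 < log_ratio_slope a b a' b' c u &
     0 < log_ratio c v].
Proof.
move=> c01 x10 x1x xle1 gx g1.
have [_ + _] := gap_change c01 (lexx 0) x10 (le_trans (ltW x1x) xle1).
rewrite gap0 => /(_ g1)[u /andP[u0 ux1] lu].
have [+ _ _] := gap_change c01 (ltW x10) x1x xle1.
rewrite gx => /(_ g1)[v /andP[x1v vx] lv].
have uv : u < v by exact: lt_trans x1v.
have [+ _] := log_ratio_change c01 u0 uv (lt_le_trans vx xle1).
move=> /(_ (lt_trans lu lv))[z /andP[uz zv] lz].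
by exists z, v; split=> //; exact: lt_trans uz.
Qed.

(** Here c = 1: [gap 1] vanishes at 0 and at 1, and a negative value would require a positive slope,
    which c = 1 excludes. *)
Lemma beta_cdf_le x : 0 <= x <= 1 -> F x <= G x.
Proof.
move=> /andP[x0 x1]; rewrite leNgt; apply/negP => GF.
have c01 : 0 < (1 : R) <= 1 by rewrite ltr01 lexx.
move: x0; rewrite le_eqVlt => /predU1P[x0|x0].
  by move: GF; rewrite -x0 (bcl0 HF) (bcl0 HG) ltxx.
move: x1; rewrite le_eqVlt => /predU1P[x1|x1].
  by move: GF; rewrite x1 (bcl1 HF) (bcl1 HG) ltxx.
have [||u [v [uv v1 u0]]] := gap_lt0 c01 x0 x1 (lexx 1).
- by rewrite /gap mulr1 (bcl1 HF) (bcl1 HG) subrr.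
- by rewrite /gap mul1r subr_lt0.
rewrite ltNge log_ratio_slope_le0//; last by left.
by rewrite u0 (lt_trans uv).
Qed.

(** Star-shapedness freed of the inverse: [y] is phi x, and applying G turns phi (t x) <= t phi x
    into this inequality. *)
Lemma beta_cdf_star x y t : 0 < x <= 1 -> 0 < y <= 1 -> G y = F x ->
  0 <= t <= 1 -> F (t * x) <= G (t * y).
Proof.
move=> /andP[x0 x1] /andP[y0 y1] GF /andP[t0 t1].
have in01 (s : R) : 0 < s -> s <= 1 -> s \in `[0, 1] by move=> ? ?; rewrite in_itv/= ltW.
have [yx|xy|xy] := ltgtP y x; last first.
- subst y; apply: beta_cdf_le.
  by rewrite mulr_ge0 ?mulr_ile1// ltW.
- have := bcl_lt HG (in01 _ x0 x1) (in01 _ y0 y1) xy.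
  by rewrite GF ltNge beta_cdf_le// (ltW x0).
(* x = 1 would give G y = 1 although y < 1. *)
have {}x1 : x < 1.
  rewrite lt_neqAle x1 andbT; apply/eqP => xE; move: GF.
  have := bcl_lt HG (in01 _ y0 y1) (in01 _ ltr01 (lexx 1)).
  by rewrite -xE => /(_ yx) + GF; rewrite GF xE (bcl1 HF) (bcl1 HG) ltxx.
pose c := y / x; have xE : y = c * x by rewrite divfK ?gt_eqF.
have c01 : 0 < c < 1 by rewrite divr_gt0//= ltr_pdivrMr// mul1r.
have c01' : 0 < c <= 1 by case/andP: c01 => -> /ltW.
move: t0; rewrite le_eqVlt => /predU1P[<-|t0].
  by rewrite !mul0r (bcl0 HF) (bcl0 HG).
move: t1; rewrite le_eqVlt => /predU1P[->|t1]; first by rewrite !mul1r GF.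
rewrite leNgt; apply/negP => GF'.
have gx : gap c x = 0 by rewrite /gap -xE GF subrr.
have [|||u [v [uv vx u0 su lv]]] := gap_lt0 c01' (x1 := t * x) _ _ (ltW x1) gx.
- exact: mulr_gt0.
- by rewrite gtr_pMl.
- by rewrite /gap mulrCA -xE subr_lt0.
(* As c < 1, [gap c 1] = G c - 1 < 0, so [log_ratio c] is nonpositive somewhere after x: its slope
   turns negative after having been positive, against the single crossing. *)
have [_ _ +] := gap_change c01' (ltW x0) x1 (lexx 1).
have -> : gap c 1 <= gap c x.
  rewrite gx /gap mulr1 (bcl1 HF) subr_le0 -(bcl1 HG) ltW//.
  apply: (bcl_lt HG); rewrite ?in_itv/= ?ler01 ?lexx//; last by case/andP: c01.
  by case/andP: c01' => /ltW -> ->.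
move=> /(_ isT)[w /andP[xw w1] lw].
have v0 := lt_trans u0 uv; have vw := lt_trans vx xw.
have [_ +] := log_ratio_change c01' v0 vw w1.
move=> /(_ (le_lt_trans lw lv))[z /andP[vz zw] sz].
have := log_ratio_single_crossing u0 (lt_trans uv vz) (lt_trans zw w1) c01 aa bb su.
by rewrite ltNge (ltW sz).
Qed.

End star_comparison.

(** * Reflection and the necessary conditions on the parameters *)

(** If X is Beta(a, b) then 1 - X is Beta(b, a): the behaviour at 1 is carried to 0, so only
    exponents at 0 need comparing. *)
Lemma beta_cdf_like_reflect (R : realType) (a b k : R) (F : R -> R) :
  beta_cdf_like a b k F -> beta_cdf_like b a k (fun x => 1 - F (1 - x)).
Proof.
move=> [cF F0 F1 k0 dF]; split=> //.
- move=> x; apply: cvgB; first exact: cvg_cst.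
  apply: (@continuous_comp _ _ _ (fun x : R => 1 - x) F); last exact: cF.
  by apply: cvgB; [exact: cvg_cst|exact: cvg_id].
- by rewrite subr0 F1 subrr.
- by rewrite subrr F0 subr0.
- move=> x x01; have x01' : 0 < 1 - x < 1 by lra.
  have dFx := dF _ x01'.
  have d1 : is_derive x (1 : R) (F \o (fun t : R => 1 - t))
    (k * rbeta_kernel a b (1 - x) * (0 - 1)) by exact: is_derive1_comp.
  have := is_deriveB (is_derive_cst (1 : R) x (1 : R)) d1.
  by rewrite !sub0r mulrN1 opprK /rbeta_kernel subKr (mulrC (x `^ _)).
Qed.

Lemma beta_cdf_le_params (R : realType) (a b a' b' k k' : R) (F G : R -> R) :
  beta_cdf_like a b k F -> beta_cdf_like a' b' k' G ->
  (forall x : R, 0 <= x <= 1 -> F x <= G x) -> a' <= a /\ b <= b'.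
Proof.
move=> HF HG FG; split; first exact: beta_cdf_ge_exponent HG HF FG.
(* Reflection reverses the inequality, so F and G exchange the roles they had for the first
   exponent. *)
apply: (beta_cdf_ge_exponent (beta_cdf_like_reflect HF) (beta_cdf_like_reflect HG)).
by move=> x x01; rewrite lerD2l lerN2 FG//; lra.
Qed.

(** * The distribution function of a Beta random variable *)

Section beta_random_variable.
Context (R : realType) (d : measure_display) (T : measurableType d)
  (P : probability T R) (X : {RV P >-> R}) (a b : R).
Hypothesis hX : beta_distributed a b X.
Local Notation mu := (@lebesgue_measure R).
Local Notation f := (rbeta_pdf a b).

Lemma rbeta_kernel_ge0 (x : R) : 0 <= rbeta_kernel a b x.
Proof. by rewrite mulr_ge0 ?powR_ge0. Qed.

Lemma rbeta_fun_ge0 : 0 <= rbeta_fun a b.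
Proof. by apply: Rintegral_ge0 => x _; exact: rbeta_kernel_ge0. Qed.

Lemma rbeta_pdf_ge0 (x : R) : 0 <= f x.
Proof.
rewrite /rbeta_pdf; case: ifP => // _.
by rewrite divr_ge0 ?rbeta_kernel_ge0 ?rbeta_fun_ge0.
Qed.

Lemma rbeta_pdf0 (x : R) : ~~ (0 < x < 1) -> f x = 0.
Proof. by rewrite /rbeta_pdf in_itv/= => /negbTE ->. Qed.

Lemma measurable_rbeta_kernel : measurable_fun setT (rbeta_kernel a b).
Proof.
apply: measurable_funM; first exact: measurable_powR.
by apply: (measurableT_comp (measurable_powR _)); exact: measurable_funB.
Qed.

Lemma measurable_rbeta_pdf : measurable_fun setT f.
Proof.
have -> : f = (fun x => rbeta_kernel a b x / rbeta_fun a b) \_ `]0, 1[.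
  by apply/funext => x; rewrite patchE /rbeta_pdf mem_setE.
apply/(measurable_restrictT _ _).1 => //; apply: measurable_funTS.
by apply: measurable_funM => //; exact: measurable_rbeta_kernel.
Qed.

Lemma integral_rbeta_pdf : (\int[mu]_x (f x)%:E = 1)%E.
Proof. by rewrite -hX// probability_setT. Qed.

(* The total mass 1 of X excludes the junk value 0 of a divergent integral. *)
Lemma rbeta_fun_gt0 : 0 < rbeta_fun a b.
Proof.
rewrite lt_neqAle rbeta_fun_ge0 andbT; apply/eqP => B0.
have := integral_rbeta_pdf; rewrite integral0_eq.
  by move/eqP; rewrite eq_sym onee_eq0.
by move=> x _; rewrite /rbeta_pdf -B0 invr0 mulr0 if_same.
Qed.

Lemma integrable_rbeta_pdf : mu.-integrable setT (EFin \o f).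
Proof.
apply/integrableP; split.
  by apply/measurable_EFinP; exact: measurable_rbeta_pdf.
under eq_integral do rewrite /= ger0_norm ?rbeta_pdf_ge0//.
by rewrite integral_rbeta_pdf ltry.
Qed.

Let integrable_rbeta_pdfS (A : set R) : measurable A ->
  mu.-integrable A (EFin \o f).
Proof. by move=> mA; apply: integrableS integrable_rbeta_pdf. Qed.

Lemma fine_cdf_rbeta (x : R) :
  fine (cdf X x) = \int[mu]_(t in `]-oo, x]) f t.
Proof. by rewrite /cdf hX. Qed.

Lemma cdf_fine (x : R) : cdf X x = (fine (cdf X x))%:E.
Proof. by rewrite fineK// fin_num_measure. Qed.

Lemma distribution_rbeta_supp (A : set R) : measurable A ->
  (forall x, 0 < x < 1 -> A x) -> distribution P X A = 1%E.
Proof.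
move=> mA A01; rewrite hX// -integral_rbeta_pdf [LHS]integral_mkcond.
apply: eq_integral => x _; rewrite patchE; case: ifPn => //.
rewrite notin_setE => Ax; rewrite rbeta_pdf0//.
by apply/negP => /A01.
Qed.

Lemma continuous_fine_cdf_rbeta : continuous (fun x => fine (cdf X x)).
Proof.
move=> x0.
(* On this window the distribution function is a constant plus an integral with variable upper end,
   which is continuous. *)
have xx : x0 - 1 < x0 + 1 by lra.
have ci := @parameterized_integral_continuous R _ _ f (ltW xx)
  (integrable_rbeta_pdfS (measurable_itv _)).
have [+ _ _] := (continuous_within_itvP _ xx).1 ci.
have x0in : x0 \in `]x0 - 1, x0 + 1[ by rewrite in_itv/=; lra.
move=> /(_ x0 x0in) cx.
have cD : {for x0, continuous (fun x => fine (cdf X (x0 - 1)) +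
    parameterized_integral mu (x0 - 1) x f)}.
  by apply: cvgD => //; exact: cvg_cst.
have eF x : x0 - 1 < x -> fine (cdf X (x0 - 1)) +
    parameterized_integral mu (x0 - 1) x f = fine (cdf X x).
  move=> x1; rewrite !fine_cdf_rbeta /parameterized_integral.
  rewrite -(Rintegral_itv_obnd_cbnd (integrable_rbeta_pdfS (measurable_itv _))).
  rewrite -Rintegral_setU//.
  - by rewrite -itv_bndbnd_setU// bnd_simp ltW.
  - exact: integrable_rbeta_pdfS (measurableU _ _ _ _).
  - apply/disj_setPLR => z/=; rewrite !in_itv/= => zx.
    by apply/negP; rewrite negb_and -leNgt zx.
rewrite /continuous_at -eF; last by lra.
apply: cvg_trans cD; apply: near_eq_cvg; near=> x; apply: eF.
by near: x; apply: lt_nbhsr; lra.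
Unshelve. all: by end_near. Qed.

Lemma beta_cdf_like_fine_cdf :
  beta_cdf_like a b (rbeta_fun a b)^-1 (fun x => fine (cdf X x)).
Proof.
split.
- exact: continuous_fine_cdf_rbeta.
- rewrite /cdf hX// integral0_eq//.
  move=> x; rewrite /= in_itv/= => x0; rewrite rbeta_pdf0//.
  by rewrite negb_and -leNgt x0.
- rewrite /cdf distribution_rbeta_supp// => x /andP[_ x1].
  by rewrite /= in_itv/= ltW.
- by rewrite invr_gt0 rbeta_fun_gt0.
- move=> x x01; have /andP[x0 x1] := x01.
  pose k := (rbeta_fun a b)^-1.
  have fE y : 0 < y < 1 -> f y = k * rbeta_kernel a b y.
    by move=> y01; rewrite /rbeta_pdf in_itv/= y01 mulrC.
  (* The fundamental theorem of calculus needs the density continuous at x; near x it is the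
     exponential of [log_kernel]. *)
  have fc : {for x, continuous f}.
    have lc : {for x, continuous (log_kernel a b k)}.
      have [dl _] := is_derive_log_kernel a b k x01.
      exact/differentiable_continuous/derivable1_diffP.
    have ec := continuous_comp lc (@continuous_expR R _).
    have ef y : 0 < y < 1 -> (expR \o log_kernel a b k) y = f y.
      by move=> y01; rewrite fE//= rbeta_kernelE// invr_gt0 rbeta_fun_gt0.
    rewrite /prop_for /continuous_at -ef//.
    apply: cvg_trans ec; apply: near_eq_cvg; near=> y; apply: ef.
    have : y \in `]0, 1[ by near: y; apply: near_in_itvoo; rewrite in_itv.
    by rewrite in_itv.
  have [dF F'] := continuous_FTC1 x1 (integrable_rbeta_pdfS (measurable_itv `]-oo, 1]))
     (ltNyr x) fc.
  rewrite -fE// -F' derive1E.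
  have -> : (fun x => fine (cdf X x)) = (fun x => \int[mu]_(t in `]-oo, x]) f t).
    by apply/funext => y; exact: fine_cdf_rbeta.
  exact: derivableP.
Unshelve. all: by end_near. Qed.

Lemma star_interval_beta : star_interval X 1.
Proof.
split => //.
  by apply: distribution_rbeta_supp => // x /andP[x0 x1]; rewrite /= in_itv/= !ltW.
move=> x y x0 xy y1; rewrite (cdf_fine x) (cdf_fine y) lte_fin.
apply: (bcl_lt beta_cdf_like_fine_cdf) => //; rewrite in_itv/=.
  by rewrite x0 (le_trans (ltW xy)).
by rewrite (le_trans x0 (ltW xy)).
Qed.

(** [star_le] leaves the interval existential, so it has to be identified. For r > 1 the
    distribution function is already 1 at 1; for r < 1, mass 1 on [0, r] makes it reach 1 at r.
    Strict increase fails either way. *)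
Lemma star_interval_beta_uniq (r : R) : star_interval X r -> r = 1.
Proof.
move=> [r0 r1 Fr].
have F1 : cdf X 1 = 1%E by rewrite cdf_fine (bcl1 beta_cdf_like_fine_cdf).
apply/eqP; rewrite eq_le; apply/andP; split; rewrite leNgt; apply/negP => rr.
  by have := Fr _ _ ler01 rr (lexx _); rewrite F1 ltNge cdf_le1.
have [_ _ F01] := star_interval_beta.
have := F01 _ _ (ltW r0) rr (lexx 1); rewrite F1 -r1 ltNge => /negP; apply.
by apply: le_measure; rewrite ?inE// => x; rewrite /= !in_itv/= => /andP[].
Qed.

End beta_random_variable.

(** * The inverse distribution function and the star-shaped order *)

(** By the intermediate value theorem every [p] in [0, 1] is attained on [0, 1], so the default
    value of the partial inverse never enters. *)
Lemma pinv_beta_cdf (R : realType) (a b k : R) (G : R -> \bar R) (p : \bar R) :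
  (forall y, G y = (fine (G y))%:E) ->
  beta_cdf_like a b k (fun x => fine (G x)) -> (0 <= p <= 1)%E ->
  let y := 'pinv_(fun=> 0) `[0, 1] G p in 0 <= y <= 1 /\ G y = p.
Proof.
move=> GE HG /andP[p0 p1].
have pE : p = (fine p)%:E.
  by rewrite fineK// ge0_fin_numE// (le_lt_trans p1)// ltry.
have injG : {in `[0, 1]%classic &, injective G}.
  move=> x y; rewrite !inE/= => x01 y01 e.
  have [xy|yx|//] := ltgtP x y.
    by have := bcl_lt HG x01 y01 xy; rewrite e ltxx.
  by have := bcl_lt HG y01 x01 yx; rewrite e ltxx.
have [||y y01 yp] := @IVT R (fun x => fine (G x)) 0 1 (fine p) ler01.
- by apply: continuous_subspaceT; exact: (bcl_cont HG).
- rewrite (bcl0 HG) (bcl1 HG) min_l// max_r//.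
  by move: p0 p1; rewrite pE !lee_fin => -> ->.
have -> : p = G y by rewrite GE yp.
rewrite pinvKV ?inE//; split=> //; by move: y01; rewrite in_itv.
Qed.

Theorem theorem2 (R : realType) (d d' : measure_display)
    (T : measurableType d) (T' : measurableType d')
    (P : probability T R) (Q : probability T' R)
    (X : {RV P >-> R}) (Y : {RV Q >-> R}) (a b a' b' : R)
    (ha : 0 < a) (hb : 0 < b) (ha' : 0 < a') (hb' : 0 < b')
    (hX : beta_distributed a b X) (hY : beta_distributed a' b' Y) :
  star_le X Y <-> (a >= a' /\ b <= b').
Proof.
have HF := beta_cdf_like_fine_cdf hX.
have HG := beta_cdf_like_fine_cdf hY.
pose phi x := 'pinv_(fun=> 0) `[0, 1] (cdf Y) (cdf X x).
have phiP x : 0 <= phi x <= 1 /\ cdf Y (phi x) = cdf X x.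
  by apply: (pinv_beta_cdf (cdf_fine Y) HG); rewrite cdf_ge0 cdf_le1.
have FG x : fine (cdf Y (phi x)) = fine (cdf X x) by case: (phiP x) => _ ->.
have phi01 x : phi x \in `[0, 1] by rewrite in_itv/=; case: (phiP x).
have G_le x y : x <= y -> fine (cdf Y x) <= fine (cdf Y y).
  by move=> xy; rewrite fine_le ?fin_num_measure// cdf_nondecreasing.
split=> [[r [s [/(star_interval_beta_uniq hX) -> /(star_interval_beta_uniq hY) ->]]]|].
  rewrite -/phi => star; apply: (beta_cdf_le_params HF HG) => t t01.
  rewrite -FG; apply: G_le.
  (* Star-shapedness at 1 gives phi t <= t * phi 1 <= t. *)
  have := star 1 t; rewrite lexx ler01 => /(_ isT t01); rewrite mulr1 => /le_trans; apply.
  by rewrite ler_piMr//; case/andP: t01 => //; case/andP: (phiP 1).1.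
move=> [aa bb]; exists 1, 1; split; [exact: star_interval_beta hX|exact: star_interval_beta hY|].
rewrite -/phi => x t /andP[x0 x1] t01; rewrite leNgt; apply/negP => tx.
have /andP[t0 t1] := t01; have /andP[y0 y1] := (phiP x).1.
have ty01 : t * phi x \in `[0, 1] by rewrite in_itv/= mulr_ge0// mulr_ile1.
(* Applying the strictly increasing G to the negated inequality leaves F (t * x) <= G (t * phi x) to
   prove. *)
have := bcl_lt HG ty01 (phi01 _) tx; rewrite FG ltNge => /negP; apply.
move: x0; rewrite le_eqVlt => /predU1P[<-|x0].
  by rewrite mulr0 (bcl0 HF) fine_ge0// cdf_ge0.
apply: (beta_cdf_star HF HG aa bb); rewrite ?x0 ?t0//.
(* phi x = 0 would give F x = G 0 = 0, against x > 0. *)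
rewrite y1 andbT lt_neqAle y0 andbT; apply/eqP => y_0.
have := bcl_lt HF _ _ x0; rewrite !in_itv/= lexx ler01 x1 (ltW x0) => /(_ isT isT).
by rewrite -(FG x) -y_0 (bcl0 HF) (bcl0 HG) ltxx.
Qed.
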